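(* Let $\Gamma,\Delta$ be finite sets of formulas in $For_1$ with $\Gamma\cup\Delta$ nonempty. If $\vDash_{\mathbf{H}_3}\Gamma\Rightarrow\Delta$, then $\Gamma\Rightarrow\Delta$ is provable in $\mathbf{H}$ without using the Cut rule. In particular, for every finite set $\Gamma\cup\{\alpha\}\subseteq For_1$, if $\Gamma\vDash_{\mathbf{H}_3}\alpha$ then $\Gamma\Rightarrow\alpha$ is provable in $\mathbf{H}$.
   Context: Fix a denumerable set $prop$ of propositional variables. $For_1$ is the set of formulas built from $prop$ with a unary connective $\lnot$ and a binary connective $\vee$. $var(\alpha)$ is the set of propositional variables in $\alpha$; $var(\Gamma)=\bigcup_{\gamma\in\Gamma}var(\gamma)$. A sequent $\Gamma\Rightarrow\Delta$ is an ordered pair of finite sets of formulas, not both empty; $\alpha,\Gamma$ denotes $\Gamma\cup\{\alpha\}$. The calculus $\mathbf{H}$ has the axiom $\alpha\Rightarrow\alpha$ and the rules (premises / conclusion): (W$\Rightarrow$) $\Gamma\Rightarrow\Delta$ / $\alpha,\Gamma\Rightarrow\Delta$; ($\Rightarrow$W) $\Gamma\Rightarrow\Delta$ / $\Gamma\Rightarrow\Delta,\alpha$; (Cut) $\Gamma\Rightarrow\Delta,\alpha$ and $\alpha,\Gamma\Rightarrow\Delta$ / $\Gamma\Rightarrow\Delta$; ($\Rightarrow\lnot$) $\alpha,\Gamma\Rightarrow\Delta$ / $\Gamma\Rightarrow\Delta,\lnot\alpha$; ($\lnot^H\Rightarrow$) $\Gamma\Rightarrow\Delta,\alpha$ / $\lnot\alpha,\Gamma\Rightarrow\Delta$,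 allowed only if $var(\alpha)\subseteq var(\Delta)$; ($\vee\Rightarrow$) $\alpha_1,\Gamma\Rightarrow\Delta$ and $\alpha_2,\Gamma\Rightarrow\Delta$ / $\alpha_1\vee\alpha_2,\Gamma\Rightarrow\Delta$; ($\Rightarrow\vee$) $\Gamma\Rightarrow\Delta,\alpha_1,\alpha_2$ / $\Gamma\Rightarrow\Delta,\alpha_1\vee\alpha_2$. Halldén's logic $\mathbf{H}_3$ on $For_1$: truth values $\{1,\tfrac12,0\}$, designated set $\{1,\tfrac12\}$; valuations map $prop$ to $\{1,\tfrac12,0\}$ and extend by $\lnot 1=0,\lnot\tfrac12=\tfrac12,\lnot0=1$, and $x\vee y=\tfrac12$ if $x=\tfrac12$ or $y=\tfrac12$, otherwise classical disjunction. $\vDash_{\mathbf{H}_3}\Gamma\Rightarrow\Delta$ means: for every valuation $v$, if $v(\gamma)$ is designated for all $\gamma\in\Gamma$ then $v(\delta)$ is designated for some $\delta\in\Delta$. $\Gamma\vDash_{\mathbf{H}_3}\alpha$ means every valuation designating all of $\Gamma$ designates $\alpha$. *)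

(* Defs.v *)
From HB Require Import structures.
From mathcomp Require Import all_boot finmap.

Set Implicit Arguments.
Unset Strict Implicit.
Unset Printing Implicit Defensive.

Local Open Scope fset_scope.

Definition prop : Type := nat.
HB.instance Definition _ := Countable.on prop.

Inductive form : Type :=
  | Var of prop
  | Neg of form
  | Or of form & form.

(* The encoding below only serves to give [form] the decidable equality and
   choice structure needed to form the type [{fset form}] of finite sets. *)
Fixpoint tree_of_form (a : form) : GenTree.tree prop :=
  match a with
  | Var p => GenTree.Leaf p
  | Neg b => GenTree.Node 0 [:: tree_of_form b]
  | Or b c => GenTree.Node 1 [:: tree_of_form b; tree_of_form c]
  end.

Fixpoint form_of_tree (t : GenTree.tree prop) : option form :=
  match t with
  | GenTree.Leaf p => Some (Var p)
  | GenTree.Node 0 [:: u] => omap Neg (form_of_tree u)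
  | GenTree.Node 1 [:: u; w] =>
      if form_of_tree u is Some b then omap (Or b) (form_of_tree w) else None
  | _ => None
  end.

Lemma tree_of_formK : pcancel tree_of_form form_of_tree.
Proof. by elim=> [p|b /= ->|b /= -> c ->]. Qed.

HB.instance Definition _ := Countable.copy form (pcan_type tree_of_formK).

Fixpoint var (a : form) : {fset prop} :=
  match a with
  | Var p => [fset p]
  | Neg b => var b
  | Or b c => var b `|` var c
  end.

Definition var_set (G : {fset form}) : {fset prop} :=
  \bigcup_(g <- G) var g.

Definition is_sequent (G D : {fset form}) : bool := G `|` D != fset0.

(* [derivable cut G D]: the sequent G => D has a derivation in the calculus H
   in which the rule (Cut) is available only if [cut] is true. Contexts are
   arbitrary finite sets, so the formulas displayed next to them in a rule may
   already belong to them (contraction is implicit). Among the axiom and the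
   rules, only (Cut) could lead from sequents to the empty pair, which is not
   a sequent; see [derivable_is_sequent]. *)
Inductive derivable (cut : bool) : {fset form} -> {fset form} -> Prop :=
  | Ax a : derivable cut [fset a] [fset a]
  | WeakL a G D : derivable cut G D -> derivable cut (a |` G) D
  | WeakR a G D : derivable cut G D -> derivable cut G (a |` D)
  | Cut a G D : cut -> is_sequent G D ->
      derivable cut G (a |` D) -> derivable cut (a |` G) D ->
      derivable cut G D
  | NegR a G D : derivable cut (a |` G) D -> derivable cut G (Neg a |` D)
  | NegL a G D : var a `<=` var_set D ->
      derivable cut G (a |` D) -> derivable cut (Neg a |` G) D
  | OrL a b G D : derivable cut (a |` G) D -> derivable cut (b |` G) D ->
      derivable cut (Or a b |` G) D
  | OrR a b G D : derivable cut G (a |` (b |` D)) ->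
      derivable cut G (Or a b |` D).

Definition provable (G D : {fset form}) : Prop := derivable true G D.
Definition cut_free_provable (G D : {fset form}) : Prop := derivable false G D.

Lemma derivable_is_sequent cut G D : derivable cut G D -> is_sequent G D.
Proof.
have memP a A B : a \in A `|` B -> is_sequent A B.
  by move=> h; apply/fset0Pn; exists a.
case=> // [a|a A B _|a A B _|a A B _|a A B _ _|a b A B _ _|a b A B _].
- by apply: (memP a); rewrite !inE eqxx.
- by apply: (memP a); rewrite !inE eqxx.
- by apply: (memP a); rewrite !inE eqxx ?orbT.
- by apply: (memP (Neg a)); rewrite !inE eqxx ?orbT.
- by apply: (memP (Neg a)); rewrite !inE eqxx.
- by apply: (memP (Or a b)); rewrite !inE eqxx.
- by apply: (memP (Or a b)); rewrite !inE eqxx ?orbT.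
Qed.

Inductive tv : Type := One | Half | Zero.

Definition designated (x : tv) : bool :=
  match x with One | Half => true | Zero => false end.

Definition neg3 (x : tv) : tv :=
  match x with One => Zero | Half => Half | Zero => One end.

Definition or3 (x y : tv) : tv :=
  match x, y with
  | Half, _ | _, Half => Half
  | Zero, Zero => Zero
  | _, _ => One
  end.

Fixpoint eval (v : prop -> tv) (a : form) : tv :=
  match a with
  | Var p => v p
  | Neg b => neg3 (eval v b)
  | Or b c => or3 (eval v b) (eval v c)
  end.

Definition valid_sequent (G D : {fset form}) : Prop :=
  forall v : prop -> tv,
    (forall g, g \in G -> designated (eval v g)) ->
    exists2 d, d \in D & designated (eval v d).

Definition consequence (G : {fset form}) (a : form) : Prop :=
  forall v : prop -> tv,
    (forall g, g \in G -> designated (eval v g)) -> designated (eval v a).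

(* Main.v *)
(** A countermodel to [Gamma => Delta] is two-valued on [var_set Delta], and the
    formulas of [Gamma] with a variable outside [var_set Delta] can all be given
    the value [Half]. Hence [Gamma => Delta] is valid iff [Gamma' => Delta] is
    classically valid, where [Gamma'] keeps the formulas of [Gamma] whose
    variables occur in [Delta]. Backward proof search for [Gamma' => Delta],
    never discarding a formula, keeps the variables of the succedent, so that the
    proviso of the left negation rule always holds; it ends in sequents that are
    weakenings of axioms [Var p => Var p]. *)

Require Import Defs.
From mathcomp Require Import all_boot finmap.
From mathcomp Require Import zify.

Local Open Scope fset_scope.

Lemma derivable_cut cut G D : derivable false G D -> derivable cut G D.
Proof.
elim=> {G D} [a|a G D _|a G D _|//|a G D _|a G D va _|a b G D _ IHa _|a b G D _].
- exact: Ax.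
- exact: WeakL.
- exact: WeakR.
- exact: NegR.
- exact: NegL.
- exact: OrL.
- exact: OrR.
Qed.

(** The elements of [B] are added to [A] one at a time along an enumeration; the result is [B]
    because [A] lies inside it. This lifts the one-formula weakening rules to arbitrary
    inclusions. *)
Lemma fset_ind_above (T : choiceType) (P : {fset T} -> Prop) (A B : {fset T}) :
  A `<=` B -> P A -> (forall x C, P C -> P (x |` C)) -> P B.
Proof.
move=> sAB PA PS.
have PU (s : seq T) : P ([fset x in s] `|` A).
  elim: s => [|x s IHs]; first by rewrite fset_nil fset0U.
  by rewrite fset_cons -fsetUA; apply: PS.
have := PU (enum_fset B); congr P; apply/fsetP=> x; rewrite !inE /=.
by apply/orP/idP=> [[//|]|xB]; [apply: (fsubsetP sAB) | left].
Qed.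

Lemma derivable_weak cut G D G' D' :
  G `<=` G' -> D `<=` D' -> derivable cut G D -> derivable cut G' D'.
Proof.
move=> sG sD dGD.
have dG'D : derivable cut G' D.
  by apply: (fset_ind_above _ (fun X => derivable cut X D) _ _ sG) => // a C; apply: WeakL.
by apply: (fset_ind_above _ (derivable cut G') _ _ sD) => // a C; apply: WeakR.
Qed.

Lemma derivable_common cut a G D : a \in G -> a \in D -> derivable cut G D.
Proof. by move=> aG aD; apply: derivable_weak (Ax cut a); rewrite fsub1set. Qed.

Lemma var_sub_var_set a (D : {fset form}) : a \in D -> var a `<=` var_set D.
Proof. by move=> aD; rewrite /var_set bigfcup_sup. Qed.

Lemma var_set_subU1 a D : var_set D `<=` var_set (a |` D).
Proof.
by apply/bigfcupsP=> b bD _; apply: var_sub_var_set; rewrite inE bD orbT.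
Qed.

Fixpoint classical_eval (v : prop -> bool) (a : form) : bool :=
  match a with
  | Var p => v p
  | Neg b => ~~ classical_eval v b
  | Or b c => classical_eval v b || classical_eval v c
  end.

Definition half_outside (V : {fset prop}) (v : prop -> bool) (p : prop) : tv :=
  if p \in V then (if v p then One else Zero) else Half.

(** [Half] is absorbing for both connectives, so one variable outside [V] spreads it to the whole
    formula; on [One] and [Zero] the tables are classical. *)
Lemma eval_half_outside V v a :
  eval (half_outside V v) a =
    if var a `<=` V then (if classical_eval v a then One else Zero) else Half.
Proof.
elim: a => [p|a /= ->|a /= -> b ->] /=.
- by rewrite fsub1set.
- by case: ifP => // _; case: classical_eval.
- rewrite fsubUset.
  by case: (var a `<=` V); case: (var b `<=` V);
    do 2?[case: classical_eval].
Qed.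

Fixpoint form_size (a : form) : nat :=
  match a with
  | Var _ => 1
  | Neg b => (form_size b).+1
  | Or b c => (form_size b + form_size c).+1
  end.

Definition forms_size (l : seq form) : nat := sumn (map form_size l).

Definition classically_valid (l r : seq form) : Prop :=
  forall v, all (classical_eval v) l -> has (classical_eval v) r.

(* Proof search: [l] and [r] list the formulas still to be decomposed, [P] and
   [Q] the variables already found on the left and on the right; [G] and [D]
   also retain the formulas already decomposed. *)
Lemma classically_valid_derivable (V : {fset prop}) (l r : seq form)
    (P Q : seq prop) (G D : {fset form}) :
  all (fun a => var a `<=` V) (l ++ r) -> V `<=` var_set D ->
  {subset l ++ map Var P <= G} -> {subset r ++ map Var Q <= D} ->
  classically_valid (l ++ map Var P) (r ++ map Var Q) ->
  derivable false G D.
Proof.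
have [n] := ubnP (forms_size l + forms_size r).
elim: n l r P Q G D => // n IHn l r P Q G D.
case: l => [|[p|a|a b] l]; rewrite /forms_size /=; last first.
- rewrite fsubUset => lt_n /andP[/andP[Va Vb] Vlr] VD sG sD val.
  have abG : Or a b \in G by apply: sG; rewrite inE eqxx.
  (* Implicit contraction: since [Or a b] already belongs to [G], the rule can be applied with all
     of [G] as context. *)
  rewrite -(fsetUidPr [fset Or a b] G _) ?fsub1set //.
  apply: OrL.
  + apply: (IHn (a :: l) r P Q) => //=; rewrite ?Va //.
    * by move: lt_n; rewrite /forms_size /=; lia.
    * move=> c; rewrite !inE => /orP[->//|cl].
      by rewrite sG ?orbT // inE cl orbT.
    * by move=> v /= /andP[va vl]; apply: val; rewrite /= va.
  + apply: (IHn (b :: l) r P Q) => //=; rewrite ?Vb //.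
    * by move: lt_n; rewrite /forms_size /=; lia.
    * move=> c; rewrite !inE => /orP[->//|cl].
      by rewrite sG ?orbT // inE cl orbT.
    * by move=> v /= /andP[vb vl]; apply: val; rewrite /= vb orbT.
- move=> lt_n /andP[Va Vlr] VD sG sD val.
  have aG : Neg a \in G by apply: sG; rewrite inE eqxx.
  rewrite -(fsetUidPr [fset Neg a] G _) ?fsub1set //.
  (* The proviso holds because [var a] is inside [V], and [V] inside [var_set D]. *)
  apply: NegL; first exact: fsubset_trans Va VD.
  apply: (IHn l (a :: r) P Q).
  + by move: lt_n; rewrite /forms_size /=; lia.
  + by move: Vlr; rewrite !all_cat /= Va.
  + exact: fsubset_trans VD (var_set_subU1 _ _).
  + by move=> c cl; rewrite sG // inE cl orbT.
  + by move=> c; rewrite !inE => /orP[->//|/sD->]; rewrite orbT.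
  + move=> v vl /=; case va: (classical_eval v a) => //=.
    by apply: val; rewrite /= va vl.
- move=> lt_n /andP[Vp Vlr] VD sG sD val.
  (* No rule is applied: [Var p] only moves to the atoms, which do not count in the measure. *)
  apply: (IHn l r (p :: P) Q) => //.
  + by move=> c; rewrite mem_cat inE orbCA -mem_cat -in_cons => /sG.
  + move=> v; rewrite all_cat /= andbCA -all_cat => vl.
    exact: val.
case: r => [|[p|a|a b] r] /=; last first.
- rewrite fsubUset => lt_n /andP[/andP[Va Vb] Vr] VD sG sD val.
  have abD : Or a b \in D by apply: sD; rewrite inE eqxx.
  rewrite -(fsetUidPr [fset Or a b] D _) ?fsub1set //.
  apply: OrR; apply: (IHn [::] [:: a, b & r] P Q) => //=; rewrite ?Va ?Vb //.
  + by move: lt_n; rewrite /forms_size /=; lia.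
  + apply: fsubset_trans VD _.
    exact: fsubset_trans (var_set_subU1 _ _) (var_set_subU1 _ _).
  + move=> c; rewrite !inE => /or3P[->//|->|cr]; first by rewrite orbT.
    by rewrite sD ?orbT // inE cr orbT.
  + by move=> v /val; rewrite /= orbA.
- move=> lt_n /andP[Va Vr] VD sG sD val.
  have aD : Neg a \in D by apply: sD; rewrite inE eqxx.
  rewrite -(fsetUidPr [fset Neg a] D _) ?fsub1set //.
  apply: NegR; apply: (IHn [:: a] r P Q) => //=; rewrite ?Va //.
  + by move: lt_n; rewrite /forms_size /=; lia.
  + by move=> c; rewrite !inE => /orP[->//|/sG->]; rewrite orbT.
  + by move=> c cr; rewrite sD // inE cr orbT.
  + by move=> v /= /andP[va /val]; rewrite /= va.
- move=> lt_n /andP[Vp Vr] VD sG sD val.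
  apply: (IHn [::] r P (p :: Q)) => //.
  + by move=> c; rewrite mem_cat inE orbCA -mem_cat -in_cons => /sD.
  + by move=> v /val; rewrite /= !has_cat /= orbCA.
move=> _ _ _ sG sD val.
(* Only atoms remain. The valuation true exactly on [P] forces some variable of [Q] to lie in
   [P]. *)
have: has (classical_eval (mem P)) (map Var Q).
  by apply: val; rewrite all_map; apply/allP.
rewrite has_map => /hasP[p pQ pP].
by apply: (@derivable_common _ (Var p)); [apply: sG | apply: sD]; rewrite map_f.
Qed.

(** The formulas filtered out take the designated value [Half] under [half_outside (var_set D) v],
    so they impose no condition on [v]. *)
Lemma valid_classically_valid (G D : {fset form}) : valid_sequent G D ->
  classically_valid [seq a <- G | var a `<=` var_set D] D.
Proof.
move=> val v vG.
have [g gG|d dD] := val (half_outside (var_set D) v).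
  rewrite eval_half_outside; case: ifP => // vg.
  by have := allP vG g; rewrite mem_filter vg gG => ->.
rewrite eval_half_outside var_sub_var_set // => dv.
by apply/hasP; exists d => //; case: classical_eval dv.
Qed.

Lemma valid_cut_free_provable (G D : {fset form}) :
  valid_sequent G D -> cut_free_provable G D.
Proof.
move=> val.
(* The filtered-out formulas stay in the left context [G], which only has to contain the list being
   decomposed. *)
apply: (@classically_valid_derivable (var_set D)
  [seq a <- G | var a `<=` var_set D] D [::] [::]); rewrite ?cats0 //.
- rewrite all_cat filter_all; apply/allP=> d; exact: var_sub_var_set.
- by move=> a; rewrite mem_filter => /andP[].
- exact: valid_classically_valid.
Qed.

Theorem mainTheorem2 :
  (forall Gamma Delta : {fset form}, Gamma `|` Delta != fset0 ->
     valid_sequent Gamma Delta -> cut_free_provable Gamma Delta) /\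
  (forall (Gamma : {fset form}) (alpha : form),
     consequence Gamma alpha -> provable Gamma [fset alpha]).
Proof.
split=> [G D _|G a Ga]; first exact: valid_cut_free_provable.
apply/derivable_cut/valid_cut_free_provable => v vG.
by exists a; [rewrite inE | apply: Ga].
Qed.
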